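(* Let $G$ be a virtually polycyclic group, let $K$ be a finite field, and let $X \subset A^G$ be a Lie algebraic $G$-subshift over $K$. If the homoclinic points of $X$ are dense in $X$, then $X$ is cellwiseable, i.e. the Lie algebra operations of $X$ can be recoded to be cellwise.
   Context: Let $G$ be a group and $A$ a finite alphabet. The full shift $A^G$ has the product topology and the left shift action $(gx)_h = x_{g^{-1}h}$. A $G$-subshift is a closed $G$-invariant subset $X \subset A^G$. A block code $f : X \to Y$ between $G$-subshifts $X \subset A^G$, $Y \subset B^G$ is a continuous $G$-equivariant map; equivalently, there are a finite set $N \subset G$ (a neighborhood of $f$) and a local function $F : A^N \to B$ with $f(x)_g = F((g^{-1}x)|_N)$. Finite powers $X^n$ are regarded as subshifts of $(A^n)^G$, so $n$-ary block codes $X^n \to X$ make sense (for $n = 0$, a $G$-invariant element of $X$). A topological conjugacy is a bijective block code. A Lie algebraic $G$-subshift over a finite field $K$ is a $G$-subshift $X$ equipped with block codes for the zero element $0$ (nullary), scalar multiplication $x \mapsto ax$ for each $a \in K$, addition $(x,y) \mapsto x+y$ and a bracket $(x,y) \mapsto [x,y]$, which make $X$ a Lie algebra over $K$ (the bracket is bilinear, satisfies $[x,x]=0$ and the Jacobi identity). It is cellwise if each of these operations admits $\{1_G\}$ as a neighborhood. It is cellwiseable if there is a cellwise Lie algebraic $G$-subshift $Y$ over $K$ and a topological conjugacy $\phi : X \to Y$ that is also an isomorphism of Lie algebras over $K$. A point $x \in X$ is homoclinic if $gx \to 0$ as $g$ escapes finite subsets of $G$. *)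

(* Defs.v *)
From HB Require Import structures.
From mathcomp Require Import all_boot all_algebra.
From mathcomp Require Import all_classical topology.

Set Implicit Arguments.
Unset Strict Implicit.
Unset Printing Implicit Defensive.

Import GRing.Theory.

Local Open Scope classical_set_scope.
Local Open Scope group_scope.

(* [groupType] is the class of all groups, finite or infinite; subgroups of an
   infinite group are represented by classical sets. *)

Section Groups.
Variable G : groupType.

Definition subgroup (H : set G) : Prop :=
  H 1 /\ forall x y, H x -> H y -> H (x * y^-1).

Definition normal_subgroup (N H : set G) : Prop :=
  [/\ subgroup N, subgroup H, N `<=` H & forall n h, N n -> H h -> N (n ^ h)].

(* H / N is cyclic: some coset t N has every coset of N in H among its integer
   powers t^k N. *)
Definition cyclic_quotient (N H : set G) : Prop :=
  exists2 t, H t & forall h, H h ->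
    exists k : nat, N ((t ^+ k)^-1 * h) \/ N (t ^+ k * h).

Definition polycyclic (H : set G) : Prop :=
  exists (n : nat) (S : nat -> set G),
    [/\ S 0%N = [set 1], S n = H &
        forall i, (i < n)%N ->
          normal_subgroup (S i) (S i.+1) /\ cyclic_quotient (S i) (S i.+1)].

Definition left_cosets (H : set G) : set (set G) :=
  range (fun g => [set g * h | h in H]).

Definition virtually_polycyclic : Prop :=
  exists H : set G,
    [/\ subgroup H, finite_set (left_cosets H) & polycyclic H].

(* Convergence along this filter is convergence as g escapes finite sets. *)
Definition cofinite : set_system G := [set P | cofinite_set P].

End Groups.

Notation full_shift G A := {ptws G -> discrete_topology A}.

Section Subshifts.
Variable G : groupType.

Definition shift (A : Type) (g : G) (x : G -> A) : G -> A :=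
  fun h => x (g^-1 * h).

Definition subshift (A : finType) (X : set (full_shift G A)) : Prop :=
  closed X /\ forall g x, X x -> X (shift g x).

(* A map defined on X is represented by a function on the whole full shift;
   only its values on X matter. *)
Definition block_code (A B : finType)
    (X : set (full_shift G A)) (Y : set (full_shift G B))
    (f : full_shift G A -> full_shift G B) : Prop :=
  [/\ forall x, X x -> Y (f x),
      {within X, continuous f} &
      forall g x, X x -> f (shift g x) = shift g (f x)].

(* The domain [N -> A] of the local function is A^N: the set N is coerced to
   the type of its elements. *)
Definition neighborhood (A B : finType)
    (X : set (full_shift G A)) (f : full_shift G A -> full_shift G B)
    (N : set G) : Prop :=
  exists F : (N -> A) -> B, forall x g, X x ->
    f x g = F (fun n : N => shift g^-1 x (val n)).

Definition topological_conjugacy (A B : finType)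
    (X : set (full_shift G A)) (Y : set (full_shift G B))
    (f : full_shift G A -> full_shift G B) : Prop :=
  block_code X Y f /\ set_bij X Y f.

(* X^2 as a subset of the full shift over A^2. *)
Definition square (A : finType) (X : set (full_shift G A)) :
    set (full_shift G (A * A)%type) :=
  [set z | X (fun g => (z g).1) /\ X (fun g => (z g).2)].

Definition unary_map (A : finType)
    (op : (G -> A) -> (G -> A)) : full_shift G A -> full_shift G A := op.

Definition binary_map (A : finType) (op : (G -> A) -> (G -> A) -> (G -> A)) :
    full_shift G (A * A)%type -> full_shift G A :=
  fun z => op (fun g => (z g).1) (fun g => (z g).2).

(* X^0 is the one-point full shift over A^0 = unit. *)
Definition nullary_map (A : finType) (c : G -> A) :
    full_shift G unit -> full_shift G A := fun=> c.

End Subshifts.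

Section LieSubshifts.
Variables (K : finFieldType) (G : groupType).

Definition lie_algebra_on (T : Type) (X : set T) (zero : T)
    (scale : K -> T -> T) (add bracket : T -> T -> T) : Prop :=
  [/\ [/\ X zero,
          forall a x, X x -> X (scale a x),
          forall x y, X x -> X y -> X (add x y) &
          forall x y, X x -> X y -> X (bracket x y)],
      [/\ forall x y z, X x -> X y -> X z -> add x (add y z) = add (add x y) z,
          forall x y, X x -> X y -> add x y = add y x,
          forall x, X x -> add zero x = x &
          forall x, X x -> exists2 y, X y & add y x = zero],
      [/\ forall a b x, X x -> scale a (scale b x) = scale (a * b)%R x,
          forall x, X x -> scale 1%R x = x,
          forall a x y, X x -> X y ->
            scale a (add x y) = add (scale a x) (scale a y) &
          forall a b x, X x -> scale (a + b)%R x = add (scale a x) (scale b x)],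
      [/\ forall x y z, X x -> X y -> X z ->
            bracket (add x y) z = add (bracket x z) (bracket y z),
          forall x y z, X x -> X y -> X z ->
            bracket x (add y z) = add (bracket x y) (bracket x z),
          forall a x y, X x -> X y ->
            bracket (scale a x) y = scale a (bracket x y) &
          forall a x y, X x -> X y ->
            bracket x (scale a y) = scale a (bracket x y)] &
      (forall x, X x -> bracket x x = zero) /\
      (forall x y z, X x -> X y -> X z ->
         add (bracket x (bracket y z))
             (add (bracket y (bracket z x)) (bracket z (bracket x y))) = zero)].

Record lie_subshift (A : finType) := LieSubshift {
  points :> set (full_shift G A);
  lzero : G -> A;
  lscale : K -> (G -> A) -> (G -> A);
  ladd : (G -> A) -> (G -> A) -> (G -> A);
  lbracket : (G -> A) -> (G -> A) -> (G -> A);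
  points_subshift : subshift points;
  lzero_block_code : block_code setT points (nullary_map lzero);
  lscale_block_code a : block_code points points (unary_map (lscale a));
  ladd_block_code : block_code (square points) points (binary_map ladd);
  lbracket_block_code :
    block_code (square points) points (binary_map lbracket);
  lie_algebra_axioms : lie_algebra_on points lzero lscale ladd lbracket }.

Definition cellwise (A : finType) (X : lie_subshift A) : Prop :=
  [/\ neighborhood setT (nullary_map (lzero X)) [set 1],
      forall a, neighborhood X (unary_map (lscale X a)) [set 1],
      neighborhood (square X) (binary_map (ladd X)) [set 1] &
      neighborhood (square X) (binary_map (lbracket X)) [set 1]].

Definition lie_morphism (A B : finType)
    (X : lie_subshift A) (Y : lie_subshift B)
    (phi : full_shift G A -> full_shift G B) : Prop :=
  [/\ phi (lzero X) = lzero Y,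
      forall a x, points X x -> phi (lscale X a x) = lscale Y a (phi x),
      forall x y, points X x -> points X y ->
        phi (ladd X x y) = ladd Y (phi x) (phi y) &
      forall x y, points X x -> points X y ->
        phi (lbracket X x y) = lbracket Y (phi x) (phi y)].

(* A topological conjugacy is bijective, so a Lie algebra morphism that is one
   is an isomorphism. *)
Definition cellwiseable (A : finType) (X : lie_subshift A) : Prop :=
  exists (B : finType) (Y : lie_subshift B)
         (phi : full_shift G A -> full_shift G B),
    [/\ cellwise Y, topological_conjugacy X Y phi & lie_morphism X Y phi].

Definition homoclinic (A : finType) (X : lie_subshift A) : set (full_shift G A) :=
  [set x | points X x /\
     (fun g => shift g x : full_shift G A) @ @cofinite G
       --> (lzero X : full_shift G A)].

End LieSubshifts.

(* Main.v *)
Require Import Defs.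
From HB Require Import structures.
From mathcomp Require Import all_boot all_algebra.
From mathcomp Require Import all_classical topology.

(* A subshift X carrying a Lie algebra structure can be recoded to a cellwise
   one as soon as it has an open ideal I whose translates intersect trivially:
   send x to the configuration g |-> g^-1 x mod I.  An open linear subspace V
   whose translates intersect trivially always exists, so it suffices to find an
   open ideal inside V.  A homoclinic point has an open centralizer, because its
   bracket with y depends only on finitely many cells of y.  Using this, every
   finite set of homoclinic points lies in an ideal M of X with open
   centralizer C(M).  By compactness W = {w | [w, X] <= V} is open, so by density
   of the homoclinic points M can be chosen with X = M + W, and then
   [C(M), X] = [C(M), W] <= V; hence V intersected with C(M) is the required open
   ideal. *)

Set Implicit Arguments.
Unset Strict Implicit.
Unset Printing Implicit Defensive.

Import GRing.Theory.

Local Open Scope classical_set_scope.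
Local Open Scope group_scope.

(** * Cylinders, compactness and local rules in the full shift *)

Definition agree (T S : Type) (N : set T) (x y : T -> S) :=
  forall n, N n -> x n = y n.

Section FullShiftTopology.
Variables (G : groupType) (A : finType).
Implicit Types (X : set (full_shift G A)) (x y : full_shift G A) (N : seq G).

Definition cylinder N x : set (full_shift G A) := agree [set` N] x.

Lemma cylinderSl N1 N2 x :
  {subset N1 <= N2} -> cylinder N2 x `<=` cylinder N1 x.
Proof. by move=> sN y xy n /sN; exact: xy. Qed.

Lemma cylinder_catl N1 N2 x : cylinder (N1 ++ N2) x `<=` cylinder N1 x.
Proof. by apply: cylinderSl => n; rewrite mem_cat => ->. Qed.

Lemma cylinder_catr N1 N2 x : cylinder (N1 ++ N2) x `<=` cylinder N2 x.
Proof. by apply: cylinderSl => n; rewrite mem_cat orbC => ->. Qed.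

Lemma nbhs_cylinder x N : nbhs x (cylinder N x).
Proof.
elim: N => [|g N IH]; first by apply: filterS filterT => y _ n.
have Hg : nbhs x [set y : full_shift G A | x g = y g].
  have := @proj_continuous G (fun=> discrete_topology A) g x [set z | x g = z].
  by apply; apply: filterS (discrete_set1 _) => _ ->.
apply: filterS (filterI Hg IH) => y [/= xyg agr] n /=.
by rewrite inE => /orP[/eqP->//|/agr].
Qed.

Lemma nbhs_full_shiftP x (U : set (full_shift G A)) :
  nbhs x U <-> exists N, cylinder N x `<=` U.
Proof.
split=> [|[N sub]]; last exact: filterS sub (nbhs_cylinder x N).
(* The filter generated by the cylinders converges to [x] in each coordinate, hence in the product
   topology, so it contains every neighbourhood of [x]. *)
pose F : set_system (full_shift G A) := [set W | exists N, cylinder N x `<=` W].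
have FF : Filter F.
  split; first by exists [::].
    move=> P Q [N1 s1] [N2 s2]; exists (N1 ++ N2) => y xy.
    by split; [apply/s1/(cylinder_catl xy)|apply/s2/(cylinder_catr xy)].
  by move=> P Q PQ [N s]; exists N; apply: subset_trans PQ.
suff cF : F --> x by move=> /cF.
apply/cvg_sup => g; apply/cvg_image.
  by rewrite eqEsubset; split=> // a _; exists (fun=> a).
move=> W; rewrite nbhs_principalE => /principal_filterP Wxg.
exists ((fun y => y g) @^-1` W).
  by exists [:: g] => y /(_ g) /= /(_ (mem_head _ _)) <-.
by rewrite image_preimage // eqEsubset; split=> // a _; exists (fun=> a).
Qed.

Lemma full_shift_compact : compact [set: full_shift G A].
Proof.
have -> : [set: full_shift G A] = [set f | forall i : G, setT (f i)].
  by rewrite eqEsubset.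
apply: (@tychonoff G (fun=> discrete_topology A) (fun=> setT)) => _.
by apply: finite_compact; exact: (@finite_finset A setT).
Qed.

Lemma full_shift_hausdorff : hausdorff_space (full_shift G A).
Proof.
by apply: (@hausdorff_product G (fun=> discrete_topology A)) => _;
  exact: discrete_hausdorff.
Qed.

Lemma closed_full_shiftP X :
  closed X <-> forall x, (forall N, exists2 y, X y & cylinder N x y) -> X x.
Proof.
split=> cX x xX; apply: cX.
  move=> U /nbhs_full_shiftP[N sub]; have [y Xy xy] := xX N.
  by exists y; split=> //; exact: sub.
by move=> N; have [y [Xy xy]] := xX _ (nbhs_cylinder x N); exists y.
Qed.

Lemma closed_compact_full_shift X : closed X -> compact X.
Proof. by move=> cX; exact: subclosed_compact cX full_shift_compact _. Qed.

(** Compactness: if every window fails, the sets [bad N] generate a proper filter on [X], and local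
    constancy at a cluster point of it gives a contradiction. *)
Lemma locally_constant_uniform X (S : Type) (f : full_shift G A -> S) :
  closed X ->
  (forall p, X p ->
     exists N, forall x, X x -> cylinder N p x -> f p = f x) ->
  exists N, forall x y, X x -> X y -> cylinder N x y -> f x = f y.
Proof.
move=> cX lcf; apply: contrapT => nN.
pose bad N := [set x | X x /\ exists y, [/\ X y, cylinder N x y & f x <> f y]].
pose F : set_system (full_shift G A) := [set P | exists N, bad N `<=` P].
have FF : ProperFilter F.
  split=> [[N /= bad0]|].
    apply: nN; exists N => x y Xx Xy xy; apply: contrapT => fxy.
    by apply: (bad0 x); split=> //; exists y.
  split; first by exists [::].
    move=> P Q [N1 s1] [N2 s2]; exists (N1 ++ N2) => x [Xx [y [Xy xy fxy]]].
    split; [apply: s1|apply: s2]; split=> //; exists y; split=> //.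
      exact: cylinder_catl xy.
    exact: cylinder_catr xy.
  by move=> P Q PQ [N s]; exists N; apply: subset_trans PQ.
have FX : F X by exists [::] => x [].
have [p [Xp clp]] := closed_compact_full_shift cX FF FX.
have [N fN] := lcf p Xp.
have FN : F (bad N) by exists N.
have [x [[Xx [y [Xy xy fxy]]] px]] := clp _ _ FN (nbhs_cylinder p N).
apply: fxy; rewrite -(fN x)// -(fN y)// => n nN'.
by rewrite px // xy.
Qed.

End FullShiftTopology.

Lemma within_continuous_full_shiftP (G : groupType) (A B : finType)
    (X : set (full_shift G A)) (f : full_shift G A -> full_shift G B) :
  {within X, continuous f} <-> forall p g, X p ->
    exists N, forall x, X x -> cylinder N p x -> f p g = f x g.
Proof.
split=> [/subspace_continuousP cf p g Xp|fN].
  have /nbhs_full_shiftP[N pN] := cf p Xp _ (nbhs_cylinder (f p) [:: g]).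
  by exists N => x Xx /pN/(_ Xx); apply; exact: mem_head.
apply/subspace_continuousP => p Xp U /nbhs_full_shiftP[M MU].
apply/nbhs_full_shiftP.
suff [N NM] : exists N, forall x, X x -> cylinder N p x ->
    cylinder M (f p) (f x) by exists N => x px Xx; exact/MU/NM.
elim: M {MU} => [|g M [N1 N1M]]; first by exists [::] => x _ _ n.
have [N2 N2g] := fN p g Xp; exists (N1 ++ N2) => x Xx px n /=.
rewrite inE => /orP[/eqP->|]; first exact: N2g Xx (cylinder_catr px).
by apply: N1M => //; exact: cylinder_catl px.
Qed.

Lemma square_closed (G : groupType) (A : finType) (X : set (full_shift G A)) :
  closed X -> closed (square X).
Proof.
move=> /closed_full_shiftP cX; apply/closed_full_shiftP => z zX.
by split; apply: cX => N; have [y [Xy1 Xy2] zy] := zX N;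
  [exists (fun g => (y g).1)|exists (fun g => (y g).2)] => // n /zy ->.
Qed.

Lemma shift_invE (G : groupType) (A : Type) (g h : G) (x : G -> A) :
  shift g^-1 x h = x (g * h).
Proof. by rewrite /shift invgK. Qed.

(** The Curtis-Hedlund-Lyndon argument: one window serves for cell 1 by uniform local constancy, and
    equivariance carries it to every cell. *)
Lemma block_code_local (G : groupType) (A B : finType)
    (X : set (full_shift G A)) (Y : set (full_shift G B)) f :
  subshift X -> block_code X Y f ->
  exists N : seq G, forall x y g, X x -> X y ->
    agree [set` N] (shift g^-1 x) (shift g^-1 y) -> f x g = f y g.
Proof.
move=> [cX sX] [_ /within_continuous_full_shiftP cf fs].
have [N fN] := locally_constant_uniform (f := fun x => f x 1) cX (cf^~ 1).
exists N => x y g Xx Xy xy.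
have := fN _ _ (sX g^-1 _ Xx) (sX g^-1 _ Xy) xy.
by rewrite !fs// !shift_invE mulg1.
Qed.

(** * Open ideals in a topologized Lie algebra *)

Section OpenIdeals.
Local Open Scope ring_scope.
Variables (K : nzRingType) (L : lmodType K) (br : L -> L -> L).

Definition linear_subspace (U : set L) :=
  U 0 /\ forall a x y, U x -> U y -> U (a *: x + y).

Definition lie_ideal (U : set L) :=
  linear_subspace U /\ forall x y, U x -> U (br x y).

Definition centralizer (U : set L) : set L :=
  [set y | forall x, U x -> br x y = 0].

Hypothesis br_linearl :
  forall z a x y, br (a *: x + y) z = a *: br x z + br y z.
Hypothesis br_linearr :
  forall z a x y, br z (a *: x + y) = a *: br z x + br z y.
Hypothesis brxx : forall x, br x x = 0.
Hypothesis br_jacobi :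
  forall x y z, br x (br y z) + (br y (br z x) + br z (br x y)) = 0.

Lemma brDl x y z : br (x + y) z = br x z + br y z.
Proof. by have := br_linearl z 1 x y; rewrite !scale1r. Qed.

Lemma brDr x y z : br z (x + y) = br z x + br z y.
Proof. by have := br_linearr z 1 x y; rewrite !scale1r. Qed.

Lemma br0l z : br 0 z = 0.
Proof. by apply: (@addIr _ (br 0 z)); rewrite -brDl !add0r. Qed.

Lemma br0r z : br z 0 = 0.
Proof. by apply: (@addIr _ (br z 0)); rewrite -brDr !add0r. Qed.

Lemma brC x y : br x y = - br y x.
Proof.
apply/eqP; rewrite -addr_eq0; apply/eqP.
by have := brxx (x + y); rewrite brDl !brDr !brxx add0r addr0.
Qed.

Lemma brNl x z : br (- x) z = - br x z.
Proof. by apply: (@addIr _ (br x z)); rewrite -brDl !addNr br0l. Qed.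

Lemma brNr x z : br z (- x) = - br z x.
Proof. by rewrite brC brNl -brC. Qed.

(** The form in which the Jacobi identity is used below: bracketing with [z] is a derivation. *)
Lemma br_derivation x y z : br (br x y) z = br (br x z) y + br x (br y z).
Proof.
rewrite brC [br (br x z) y]brC (brC x z) brNr opprK; apply/eqP.
by rewrite eq_sym -addr_eq0 [br y _ + _]addrC -addrA br_jacobi.
Qed.

Lemma linear_subspaceD U x y : linear_subspace U -> U x -> U y -> U (x + y).
Proof. by move=> [_ /(_ 1 x y)]; rewrite scale1r. Qed.

Lemma linear_subspaceN U x : linear_subspace U -> U x -> U (- x).
Proof. by move=> [U0 /(_ (-1) x 0)]; rewrite scaleN1r addr0 => + Ux; exact. Qed.

(* [O] plays the role of the filter of neighbourhoods of [0]. *)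
Variable O : set_system L.
Context {O_filter : Filter O}.
Hypothesis O_bracket : forall z U, O U -> O [set y | U (br z y)].

(** The elements with open centralizer, an algebraic substitute for homoclinic points. *)
Definition fin_centralized : set L := [set x | O [set y | br x y = 0]].

(** For a subshift, the finite cover comes from the finiteness of the set of patterns on a window,
    and the choice of [E] from the density of homoclinic points. *)
Hypothesis O_precompact : forall U, O U -> exists E : seq L,
  [set` E] `<=` fin_centralized /\ forall y, exists2 e, e \in E & U (y - e).

Lemma centralizer_seq (E : seq L) :
  [set` E] `<=` fin_centralized -> O (centralizer [set` E]).
Proof.
elim: E => [|e E IH] sub; first by apply: filterS filterT => y _ x.
have eO : O [set y | br e y = 0] by apply: (sub e) => /=; exact: mem_head.
have EO : O (centralizer [set` E]).
  by apply: IH => x xE; apply: sub; rewrite /= inE xE orbT.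
by apply: filterS (filterI eO EO) => y [/= ey Ey] x /=; rewrite inE =>
  /orP[/eqP->|/Ey].
Qed.

(** By the derivation rule, [y] centralizes [[d, e]] as soon as both [y] and [[d, y]] centralize
    [e]; each is an open condition on [y]. *)
Lemma fin_centralized_br d e : fin_centralized e -> fin_centralized (br d e).
Proof.
move=> fe; apply: filterS (filterI fe (O_bracket d fe)) => y [/= ey dey].
by rewrite br_derivation ey br0r addr0 brC dey oppr0.
Qed.

(* Closing the finite set [F] under brackets with a finite set [E] such that
   [E + C(F)] is everything already yields an ideal: for [f] in [F] we have
   [[f, L] = [f, E]], and the elements [m] with [[m, L]] inside the closure are
   themselves stable under [[., E]].  This ideal lies in the span of [F] and
   [[L, E]], whence its centralizer is open. *)
Lemma fin_centralized_ideal (F : seq L) : [set` F] `<=` fin_centralized ->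
  exists M, [/\ lie_ideal M, [set` F] `<=` M & O (centralizer M)].
Proof.
move=> finF; have [E [finE EF]] := O_precompact (centralizer_seq finF).
pose clos (S : set L) := [/\ linear_subspace S, [set` F] `<=` S &
  forall m e, S m -> e \in E -> S (br m e)].
(* As [M] is the least closed set, applying a membership in [M] to another closed set is a proof by
   induction. *)
pose M := [set x | forall S, clos S -> S x].
have cM : clos M.
  split.
  - split=> [S [[]] //|a x y Mx My S cS].
    by have [[_ lS] _ _] := cS; apply: lS; [exact: Mx|exact: My].
  - by move=> x Fx S [_ + _]; exact.
  - by move=> m e Mm eE S cS; have [_ _ brS] := cS; apply: brS => //; apply: Mm.
have [lM FM brM] := cM.
exists M; split=> //.
  split=> // x y Mx; move: y.
  suff [] : (M `&` [set x | forall y, M (br x y)]) x by [].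
  apply: Mx; split.
  - split; first by split=> [|y] /=; rewrite ?br0l; case: lM.
    move=> a u v [Mu bu] [Mv bv]; split; first exact: (proj2 lM).
    by move=> y /=; rewrite br_linearl; apply: (proj2 lM).
  - move=> f Ff; split=> [|y /=]; first exact: FM.
    (* [y - e] centralizes [F], so [[f, y] = [f, e]]. *)
    have [e eE /(_ f Ff)] := EF y; rewrite brDr brNr => /eqP.
    by rewrite subr_eq0 => /eqP ->; exact: (brM _ _ (FM _ Ff) eE).
  - move=> m e [Mm bm] eE; split=> [|y /=]; first exact: (brM _ _ Mm eE).
    (* [[[m, e], y] = [[m, y], e] + [m, [e, y]]], and all brackets with [m] lie in [M] by
       induction. *)
    rewrite br_derivation.
    exact: (linear_subspaceD lM (brM _ _ (bm y) eE) (bm _)).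
(* For a fixed [e] in [E] the bracket [[m, e]] depends only on [m] modulo the open centralizer of
   [e], so it takes finitely many values; [D] collects them. *)
have [D [finD brD]] : exists D : seq L, [set` D] `<=` fin_centralized /\
    forall e m, e \in E -> br m e \in D.
  have : forall x, x \in E -> fin_centralized x by move=> x; apply: finE.
  elim: (E) => [_|e E' IH fE]; first by exists [::]; split.
  have [x xE'|D [finD DE]] := IH; first by apply: fE; rewrite inE xE' orbT.
  have fe : fin_centralized e by apply: fE; exact: mem_head.
  have [R [_ RC]] := O_precompact fe.
  exists ([seq br r e | r <- R] ++ D); split.
    move=> x /=; rewrite mem_cat => /orP[/mapP[r _ ->]|]; last exact: finD.
    exact: fin_centralized_br.
  move=> e' m; rewrite inE => /orP[/eqP->|/(DE e' m) mD].
    have [r rR /=] := RC m; rewrite brDr brNr => /eqP.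
    by rewrite subr_eq0 => /eqP h; rewrite brC h -brC mem_cat map_f.
  by rewrite mem_cat mD orbT.
(* Whatever centralizes [F] and [D] centralizes [M], by induction: every bracket that the closure
   adds is already in [D]. *)
apply: filterS (centralizer_seq (E := F ++ D) _) => [c Cc x Mx|x /=].
  apply: (Mx [set x | br x c = 0]); split.
  - split=> [|a u v /= uc vc]; first exact: br0l.
    by rewrite br_linearl uc vc scaler0 addr0.
  - by move=> f Ff; apply: Cc; rewrite /= mem_cat Ff.
  - move=> m e _ /(brD e m) mD; apply: Cc.
    by rewrite /= mem_cat mD orbT.
by rewrite mem_cat => /orP[/finF|/finD].
Qed.

Lemma open_ideal (V : set L) : linear_subspace V -> O V ->
  O [set w | forall z, V (br w z)] ->
  exists I, [/\ lie_ideal I, O I & I `<=` V].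
Proof.
move=> lV oV oW; have [F [finF FW]] := O_precompact oW.
have [M [[lM brM] FM oCM]] := fin_centralized_ideal finF.
exists (V `&` centralizer M); split; last by move=> x [].
- split.
    split; first by split=> [|m _]; [case: lV|exact: br0r].
    move=> a x y [Vx Cx] [Vy Cy]; split; first by apply: (proj2 lV).
    by move=> m Mm; rewrite br_linearr Cx// Cy// scaler0 addr0.
  move=> x y [Vx Cx]; split.
    (* [x] centralizes [f], which lies in [M], so [[x, y] = [x, y - f]], and brackets with [y - f]
       fall in [V]. *)
    have [f fF /(_ x)] := FW y; rewrite brC brDr brNr => Vxy.
    have := linear_subspaceN lV Vxy.
    by rewrite opprK [br x f]brC (Cx f (FM _ fF)) !oppr0 addr0.
  (* The centralizer of an ideal is an ideal: [[x, m]] vanishes and [[y, m]] is again in [M]. *)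
  move=> m Mm; rewrite brC br_derivation [br x m]brC (Cx m Mm) oppr0 br0l add0r.
  by rewrite [br y m]brC brNr [br x _]brC (Cx _ (brM _ _ Mm)) !oppr0.
- exact: filterI.
Qed.
End OpenIdeals.

(** * The Lie algebra of points of a subshift and its open ideals *)

Section LiePoints.
Variables (K : finFieldType) (G : groupType) (A : finType).
Variable X : lie_subshift K G A.

(** The axioms hold only on [X], so the module structure is put on a subtype. *)
Definition lie_point := set_type (points X).
HB.instance Definition _ := Choice.on lie_point.

Definition config (x : lie_point) : full_shift G A := val x.
Definition mkpoint x (Xx : points X x) : lie_point := exist _ x (mem_set Xx).

Lemma configP (x : lie_point) : points X (config x).
Proof. exact: set_mem (valP x). Qed.

Lemma config_inj : injective config. Proof. exact: val_inj. Qed.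

Lemma config_ext (x y : lie_point) :
  (forall g, config x g = config y g) -> x = y.
Proof. by move=> xy; apply/config_inj/funext. Qed.

Lemma lzeroP : points X (lzero X).
Proof. by have [[]] := lie_algebra_axioms X. Qed.

Lemma lscaleP a x : points X x -> points X (lscale X a x).
Proof. by have [[_ h _ _] _ _ _ _] := lie_algebra_axioms X; exact: h. Qed.

Lemma laddP x y : points X x -> points X y -> points X (ladd X x y).
Proof. by have [[_ _ h _] _ _ _ _] := lie_algebra_axioms X; exact: h. Qed.

Lemma lbracketP x y : points X x -> points X y -> points X (lbracket X x y).
Proof. by have [[_ _ _ h] _ _ _ _] := lie_algebra_axioms X; exact: h. Qed.

Definition pzero : lie_point := mkpoint lzeroP.
Definition pscale a (x : lie_point) : lie_point :=
  mkpoint (lscaleP a (configP x)).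
Definition padd (x y : lie_point) : lie_point :=
  mkpoint (laddP (configP x) (configP y)).
Definition pbracket (x y : lie_point) : lie_point :=
  mkpoint (lbracketP (configP x) (configP y)).

Lemma paddA : associative padd.
Proof.
move=> x y z; apply: config_inj.
by have [_ [h _ _ _] _ _ _] := lie_algebra_axioms X; apply: h; exact: configP.
Qed.
Lemma paddC : commutative padd.
Proof.
move=> x y; apply: config_inj.
by have [_ [_ h _ _] _ _ _] := lie_algebra_axioms X; apply: h; exact: configP.
Qed.
Lemma padd0 : left_id pzero padd.
Proof.
move=> x; apply: config_inj.
by have [_ [_ _ h _] _ _ _] := lie_algebra_axioms X; apply: h; exact: configP.
Qed.
Lemma pscaleA a b x : pscale a (pscale b x) = pscale (a * b)%R x.
Proof.
apply: config_inj.
by have [_ _ [h _ _ _] _ _] := lie_algebra_axioms X; apply: h; exact: configP.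
Qed.
Lemma pscale1 : left_id 1%R pscale.
Proof.
move=> x; apply: config_inj.
by have [_ _ [_ h _ _] _ _] := lie_algebra_axioms X; apply: h; exact: configP.
Qed.
Lemma pscaleDr : right_distributive pscale padd.
Proof.
move=> a x y; apply: config_inj.
by have [_ _ [_ _ h _] _ _] := lie_algebra_axioms X; apply: h; exact: configP.
Qed.
Lemma pscaleDl x : {morph pscale^~ x : a b / (a + b)%R >-> padd a b}.
Proof.
move=> a b; apply: config_inj.
by have [_ _ [_ _ _ h] _ _] := lie_algebra_axioms X; apply: h; exact: configP.
Qed.
(** The axioms only assert that opposites exist; scaling by -1 supplies the function. That [0 x = 0]
    follows by cancelling in [0 x = 0 x + 0 x]. *)
Lemma paddN : left_inverse pzero (pscale (-1)%R) padd.
Proof.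
move=> x; suff x0 : pscale 0%R x = pzero.
  by rewrite -{2}(pscale1 x) -pscaleDl addNr x0.
have [_ [_ _ _ /(_ _ (configP (pscale 0%R x)))[y Xy yx]] _ _ _] :=
  lie_algebra_axioms X.
have {}yx : padd (mkpoint Xy) (pscale 0%R x) = pzero.
  by exact: config_inj.
by rewrite -yx -{2}(addr0 0%R) pscaleDl paddA yx padd0.
Qed.

HB.instance Definition _ := GRing.isZmodule.Build lie_point
  paddA paddC padd0 paddN.
HB.instance Definition _ := GRing.Zmodule_isLmodule.Build K lie_point
  pscaleA pscale1 pscaleDr pscaleDl.

Lemma pbracket_linearl z (a : K) (x y : lie_point) :
  pbracket (a *: x + y)%R z = (a *: pbracket x z + pbracket y z)%R.
Proof.
have [_ _ _ [hD _ hZ _] _] := lie_algebra_axioms X; apply: config_inj.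
apply: etrans (hD _ _ _ _ _ _) _; try exact: configP.
by congr ladd; apply: hZ; exact: configP.
Qed.

Lemma pbracket_linearr z (a : K) (x y : lie_point) :
  pbracket z (a *: x + y)%R = (a *: pbracket z x + pbracket z y)%R.
Proof.
have [_ _ _ [_ hD _ hZ] _] := lie_algebra_axioms X; apply: config_inj.
apply: etrans (hD _ _ _ _ _ _) _; try exact: configP.
by congr ladd; apply: hZ; exact: configP.
Qed.

Lemma pbracketxx x : pbracket x x = 0%R.
Proof.
have [_ _ _ _ [h _]] := lie_algebra_axioms X; apply: config_inj.
exact: h (configP x).
Qed.

Lemma pbracket_jacobi x y z :
  (pbracket x (pbracket y z) +
     (pbracket y (pbracket z x) + pbracket z (pbracket x y)))%R = 0%R.
Proof.
have [_ _ _ _ [_ h]] := lie_algebra_axioms X; apply: config_inj.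
by apply: h; exact: configP.
Qed.

(** The source of the nullary code is a single point, fixed by every shift, so its image is fixed as
    well. *)
Lemma lzero_constant g h : lzero X g = lzero X h.
Proof.
suff h1 k : lzero X k = lzero X 1 by rewrite !h1.
have [_ _ /(_ k^-1 (fun=> tt) I)] := lzero_block_code X.
by move/(congr1 (@^~ 1)); rewrite /nullary_map shift_invE mulg1.
Qed.

Definition pshift g (x : lie_point) : lie_point :=
  mkpoint ((points_subshift X).2 g _ (configP x)).

Lemma pshiftE g x h : config (pshift g x) h = config x (g^-1 * h).
Proof. by []. Qed.

Lemma pshiftZ g (a : K) (x : lie_point) :
  pshift g (a *: x)%R = (a *: pshift g x)%R.
Proof.
apply: config_inj; have [_ _ h] := lscale_block_code X a.
exact/esym/(h g _ (configP x)).
Qed.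

Lemma pshiftD g (x y : lie_point) :
  pshift g (x + y)%R = (pshift g x + pshift g y)%R.
Proof.
apply: config_inj; have [_ _ h] := ladd_block_code X.
apply/esym/(h g (fun h => (config x h, config y h))).
by split; exact: configP.
Qed.

Lemma pshift_bracket g (x y : lie_point) :
  pshift g (pbracket x y) = pbracket (pshift g x) (pshift g y).
Proof.
apply: config_inj; have [_ _ h] := lbracket_block_code X.
apply/esym/(h g (fun h => (config x h, config y h))).
by split; exact: configP.
Qed.

(** The cells that a local rule with window [N] reads in order to compute the cells in [F]. *)
Definition translates (F N : seq G) := [seq g * n | g <- F, n <- N].

Lemma agree_translates (F N : seq G) (x y : G -> A) g :
  agree [set` translates F N] x y -> g \in F ->
  agree [set` N] (shift g^-1 x) (shift g^-1 y).
Proof.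
by move=> xy gF n nN; rewrite !shift_invE; apply: xy; exact: allpairs_f.
Qed.

(** The window is chosen before [F], so it serves all cells at once. *)
Lemma binary_local op : block_code (square X) X (binary_map op) ->
  exists N, forall F (x x' y y' : lie_point),
    agree [set` translates F N] (config x) (config x') ->
    agree [set` translates F N] (config y) (config y') ->
    agree [set` F] (op (config x) (config y)) (op (config x') (config y')).
Proof.
have [cX sX] := points_subshift X.
have sX2 : subshift (square X).
  split=> [|g z [z1 z2]]; first exact: square_closed.
  by split; [exact: (sX g _ z1)|exact: (sX g _ z2)].
move=> /(block_code_local sX2)[N opN]; exists N => F x x' y y' xx' yy' g gF.
apply: (opN (fun h => (config x h, config y h))
            (fun h => (config x' h, config y' h)) g).
- by split; exact: configP.
- by split; exact: configP.
- move=> n nN; apply/eqP; rewrite xpair_eqE; apply/andP.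
  by split; apply/eqP;
    [exact: (agree_translates xx' gF)|exact: (agree_translates yy' gF)].
Qed.

Lemma unary_local op : block_code X X (unary_map op) ->
  exists N, forall F (x x' : lie_point),
    agree [set` translates F N] (config x) (config x') ->
    agree [set` F] (op (config x)) (op (config x')).
Proof.
move=> /(block_code_local (points_subshift X))[N opN].
exists N => F x x' xx' g gF; apply: opN; try exact: configP.
exact: agree_translates xx' gF.
Qed.

(** The neighbourhoods of 0 for the topology induced on [X]; this instantiates [O]. *)
Definition nbhs0 : set_system lie_point := [set U | exists N : seq G,
  forall x, agree [set` N] (config x) (config 0%R) -> U x].

Instance nbhs0_filter : Filter nbhs0.
Proof.
split; first by exists [::].
  move=> P Q [N1 N1P] [N2 N2Q]; exists (N1 ++ N2) => x x0.
  by split; [apply: N1P|apply: N2Q] => n /= nN; apply: x0;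
    rewrite /= mem_cat nN ?orbT.
by move=> P Q PQ [N NP]; exists N => x /NP /PQ.
Qed.

Lemma nbhs0_bracketr z U : nbhs0 U -> nbhs0 [set y | U (pbracket z y)].
Proof.
move=> [F FU]; have [N brN] := binary_local (lbracket_block_code X).
exists (translates F N) => y y0; apply: FU => g gF.
rewrite -[0%R](@br0r _ _ pbracket pbracket_linearr z).
exact: brN y0 g gF.
Qed.

(** The window of the bracket does not depend on [z]; this uniformity makes the set W of the
    overview open. *)
Lemma nbhs0_bracketl U :
  nbhs0 U -> nbhs0 [set w | forall z, U (pbracket w z)].
Proof.
move=> [F FU]; have [N brN] := binary_local (lbracket_block_code X).
exists (translates F N) => w w0 z; apply: FU => g gF.
rewrite -[0%R](@br0l _ _ pbracket pbracket_linearl z).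
exact: brN w0 _ g gF.
Qed.

Lemma nbhs0_sub U : nbhs0 U -> exists N : seq G, forall x y : lie_point,
  agree [set` N] (config x) (config y) -> U (x - y)%R.
Proof.
move=> [F FU]; have [N addN] := binary_local (ladd_block_code X).
exists (translates F N) => x y xy; apply: FU => g gF.
(* Compare [x - y] with [y - y]: only the first summand changes, so the window of addition
   suffices. *)
by rewrite -(subrr y); exact: addN xy _ g gF.
Qed.

(** Testing the convergence on cell 1 alone already reads every cell of [x], since cell 1 of
    [shift g^-1 x] is [x g]. *)
Lemma homoclinic_support x : homoclinic X x ->
  exists F : seq G, forall g, g \notin F -> x g = lzero X g.
Proof.
move=> [_ /(_ _ (nbhs_cylinder (lzero X : full_shift G A) [:: 1]))].
move=> /finite_seqP[S xS]; exists [seq g^-1 | g <- S] => g gS.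
apply: contrapT => xg; move/negP: gS; apply.
rewrite -[g]invgK; apply: map_f.
suff : [set` S] g^-1 by [].
rewrite -xS => /= /(_ 1 (mem_head _ _)).
by rewrite shift_invE mulg1 (lzero_constant 1 g) => /esym.
Qed.

Lemma homoclinic_fin_centralized (x : lie_point) : homoclinic X (config x) ->
  fin_centralized pbracket nbhs0 x.
Proof.
move=> /homoclinic_support[F xF].
have [N brN] := binary_local (lbracket_block_code X).
(* [Q] consists of the cells whose window meets the support [F]. On [Q] the bracket vanishes because
   [y] looks like 0 there; elsewhere because [x] does. *)
pose Q := [seq f * n^-1 | f <- F, n <- N].
exists (translates Q N) => y y0; apply: config_ext => g.
have [gQ|gQ] := boolP (g \in Q).
  rewrite -[in RHS](@br0r _ _ pbracket pbracket_linearr x).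
  exact: brN y0 g gQ.
rewrite -[in RHS](@br0l _ _ pbracket pbracket_linearl y).
apply: (brN [:: g]) => //; last exact: mem_head.
move=> h /= /allpairsP[[g' n] /= [+ nN ->]]; rewrite inE => /eqP ->.
apply: xF; apply: contra gQ => gnF.
by apply/allpairsP; exists (g * n, n); split=> //=; rewrite mulgK.
Qed.

Hypothesis dense_homoclinic : points X `<=` closure (homoclinic X).

Lemma nbhs0_precompact U : nbhs0 U -> exists E : seq lie_point,
  [set` E] `<=` fin_centralized pbracket nbhs0 /\
  forall y, exists2 e, e \in E & U (y - e)%R.
Proof.
move=> /nbhs0_sub[N NU].
pose patt (x : lie_point) : (size N).-tuple A :=
  map_tuple (config x) (in_tuple N).
have pattP x y : patt x = patt y -> agree [set` N] (config x) (config y).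
  by move=> /(congr1 val)/= /eq_in_map.
pose S p := [set x | fin_centralized pbracket nbhs0 x /\ patt x = p].
(* A pattern without a suitable point gets the default 0, whose centralizer is everything. *)
pose e p := xget 0%R (S p).
exists [seq e p | p <- enum {: (size N).-tuple A}]; split.
  move=> _ /= /mapP[p _ ->]; rewrite /e; case: xgetP => [x _ []//|_].
  exists [::] => y _; exact: (@br0l _ _ pbracket pbracket_linearl y).
move=> y; exists (e (patt y)); first by rewrite map_f ?mem_enum.
apply: NU; apply: pattP.
have [x [hx yx]] := dense_homoclinic (configP y) (nbhs_cylinder (config y) N).
have Sx : S (patt y) (mkpoint hx.1).
  split; first exact: homoclinic_fin_centralized.
  by apply: val_inj; apply/eq_in_map => n nN /=; rewrite [RHS]yx.
by rewrite /e; case: xgetP => [x' _ []//|/(_ _ Sx)].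
Qed.

(** The subspace V of the overview. Addition need not be cellwise, so vanishing at cell 1 would not
    define a subspace; quantifying over [u] and [a] does. *)
Definition inert : set lie_point :=
  [set h | forall a u, config (u + a *: h)%R 1 = config u 1].

Lemma inert_linear : linear_subspace inert.
Proof.
split=> [a u|a x y Vx Vy b u]; first by rewrite scaler0 addr0.
by rewrite scalerDr addrA Vy scalerA Vx.
Qed.

Lemma nbhs0_inert : nbhs0 inert.
Proof.
have [N addN] := binary_local (ladd_block_code X).
have /choice[M scN] := fun a => unary_local (lscale_block_code X a).
(* The window for [u + a *: h] at cell 1; [K] is finite, so the union over all [a] is still
   finite. *)
pose T a := translates (translates [:: 1] N) (M a).
exists (flatten [seq T a | a <- enum K]) => h h0 a u.
rewrite -[u in RHS]addr0 -(scaler0 _ a).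
apply: (addN [:: 1]) => //; last exact: mem_head.
apply: scN => g gM; apply: h0 => /=; apply/flattenP.
by exists (T a); rewrite // map_f ?mem_enum.
Qed.

(** Taking [u = 0] and [a = 1], each translate of [x] agrees with 0 at cell 1. *)
Lemma inert_shift_eq0 (x : lie_point) :
  (forall g, inert (pshift g x)) -> x = 0%R.
Proof.
move=> xV; apply: config_ext => g.
have xg : shift g^-1 (config x) 1 = lzero X 1.
  by have := xV g^-1 1%R 0%R; rewrite add0r scale1r.
by rewrite shift_invE mulg1 in xg; rewrite xg; exact: lzero_constant.
Qed.

Lemma inert_ideal : exists I : set lie_point,
  [/\ lie_ideal pbracket I, nbhs0 I & I `<=` inert].
Proof.
apply: (@open_ideal _ _ pbracket pbracket_linearl pbracket_linearr
  pbracketxx pbracket_jacobi nbhs0) => //.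
- exact: nbhs0_bracketr.
- exact: nbhs0_precompact.
- exact: inert_linear.
- exact: nbhs0_inert.
- exact: nbhs0_bracketl nbhs0_inert.
Qed.
End LiePoints.

(** * Recoding by cosets of an open ideal *)

Lemma cellwise_block_code (G : groupType) (A B : finType)
    (X : set (full_shift G A)) (Y : set (full_shift G B))
    (f : full_shift G A -> full_shift G B) (F : A -> B) :
  (forall x g, f x g = F (x g)) -> (forall x, X x -> Y (f x)) ->
  block_code X Y f.
Proof.
move=> fF fXY; split=> //.
  apply/within_continuous_full_shiftP => p g _; exists [:: g] => x _ px.
  by rewrite !fF (px g (mem_head _ _)).
by move=> g x _; apply/funext => h; rewrite fF /shift fF.
Qed.

Lemma cellwise_neighborhood (G : groupType) (A B : finType)
    (X : set (full_shift G A)) (f : full_shift G A -> full_shift G B)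
    (F : A -> B) :
  (forall x g, f x g = F (x g)) -> neighborhood X f [set 1].
Proof.
move=> fF; pose one : [set 1 : G] := exist _ 1 (mem_set erefl).
by exists (fun p => F (p one)) => x g _; rewrite fF shift_invE mulg1.
Qed.

Section Recoding.
Variables (K : finFieldType) (G : groupType) (A : finType).
Variable X : lie_subshift K G A.
Local Notation L := (lie_point X).
Variable I : set L.
Hypotheses (idealI : lie_ideal (pbracket (X := X)) I)
  (sub_inert : I `<=` inert (X := X)).
Variable N : seq G.
Hypothesis openI : forall x y : L,
  agree [set` N] (config x) (config y) -> I (x - y)%R.

Local Notation B := ((size N).-tuple A).

Lemma idealD x y : I x -> I y -> I (x + y)%R.
Proof. exact: linear_subspaceD idealI.1. Qed.

Lemma idealN x : I x -> I (- x)%R.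
Proof. exact: linear_subspaceN idealI.1. Qed.

Definition representative (x : L) : L := xget 0%R [set y | I (x - y)%R].

Lemma representativeP x : I (x - representative x)%R.
Proof.
rewrite /representative; case: xgetP => [y _ //|/(_ x)/=[]].
by rewrite subrr; exact: idealI.1.1.
Qed.

(** Encodes the coset of [x] modulo [I] as a symbol of a finite alphabet: by [openI] the pattern of
    the representative on [N] determines the coset. *)
Definition cell (x : L) : B :=
  map_tuple (config (representative x)) (in_tuple N).

Lemma cellP x y : cell x = cell y <-> I (x - y)%R.
Proof.
split=> [/(congr1 val)/eq_in_map/openI xy|xy].
  rewrite -(subrK (representative x) x) -addrA; apply: idealD.
    exact: representativeP.
  rewrite -(subrK (representative y) (representative x)) -addrA.
  by apply: idealD => //; rewrite -opprB; exact/idealN/representativeP.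
(* Congruent points get the same representative because [xget] chooses from equal sets. *)
suff E : [set z | I (x - z)%R] = [set z | I (y - z)%R].
  by rewrite /cell /representative E.
apply/seteqP; split=> z /= h; [rewrite -(subrKA x)|rewrite -(subrKA y)].
  by apply: idealD => //; rewrite -opprB; exact: idealN.
exact: idealD.
Qed.

(** A section of [cell] up to [I]; a symbol that encodes no coset is sent to 0. *)
Definition lift (b : B) : L := xget 0%R [set x | cell x = b].

Lemma liftP x : I (lift (cell x) - x)%R.
Proof. by apply/cellP; rewrite /lift; case: xgetP => [y _ //|/(_ x)[]]. Qed.

Definition recode (x : L) : full_shift G B := fun g => cell (pshift g^-1 x).

Definition cell_scale a (y : G -> B) : G -> B :=
  fun g => cell (a *: lift (y g))%R.
Definition cell_add (y z : G -> B) : G -> B :=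
  fun g => cell (lift (y g) + lift (z g))%R.
Definition cell_bracket (y z : G -> B) : G -> B :=
  fun g => cell (pbracket (lift (y g)) (lift (z g))).

Lemma recode0 : recode 0%R = fun=> cell 0%R.
Proof.
apply/funext => g; congr cell; apply: config_ext => h.
exact: lzero_constant.
Qed.

Lemma recodeZ a x : recode (a *: x)%R = cell_scale a (recode x).
Proof.
apply/funext => g; apply/cellP; rewrite pshiftZ -scalerBr -opprB scalerN.
apply: idealN; rewrite -[(_ *: _)%R]addr0.
by apply: (proj2 idealI.1); [exact: liftP|exact: idealI.1.1].
Qed.

Lemma recodeD x y : recode (x + y)%R = cell_add (recode x) (recode y).
Proof.
apply/funext => g; apply/cellP; rewrite pshiftD -opprB; apply: idealN.
by rewrite opprD addrACA; apply: idealD; exact: liftP.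
Qed.

Lemma recode_bracket x y :
  recode (pbracket x y) = cell_bracket (recode x) (recode y).
Proof.
apply/funext => g; apply/cellP; rewrite pshift_bracket.
set u := pshift _ x; set v := pshift _ y.
have [brl brr] := (@pbracket_linearl _ _ _ X, @pbracket_linearr _ _ _ X).
pose brC := @brC _ _ (pbracket (X := X)) brl brr (@pbracketxx _ _ _ X).
(* [[a, b] - [c, d] = [a - c, b] + [c, b - d]]; the second term uses antisymmetry, as [lie_ideal]
   absorbs on one side. *)
have brI a b c d : I (a - c)%R -> I (b - d)%R ->
    I (pbracket a b - pbracket c d)%R.
  move=> ac bd; rewrite -(subrKA (pbracket c b)); apply: idealD.
    by rewrite -(brNl brl) -(brDl brl); exact: idealI.2.
  by rewrite -(brNr brl brr (@pbracketxx _ _ _ X)) -(brDr brr) brC;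
    apply/idealN/idealI.2.
by rewrite -opprB; apply/idealN/brI; exact: liftP.
Qed.

Lemma recode_shift g x : shift g (recode x) = recode (pshift g x).
Proof.
apply/funext => h; rewrite /recode /shift; congr cell; apply: config_ext => k.
by rewrite !pshiftE !invgK mulgA.
Qed.

(** If the codes agree, all translates of [x - y] lie in [I], hence in [inert], which forces
    [x - y = 0]. *)
Lemma recode_inj : injective recode.
Proof.
move=> x y xy; apply/eqP; rewrite -subr_eq0; apply/eqP.
apply: inert_shift_eq0 => g; apply: sub_inert.
rewrite -scaleN1r pshiftD pshiftZ scaleN1r; apply/cellP.
by have := congr1 (@^~ g^-1) xy; rewrite /recode invgK.
Qed.

(** Block codes are functions on the whole full shift, so points outside [X] need a value. *)
Definition to_point (x : full_shift G A) : L :=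
  if pselect (points X x) is left Xx then mkpoint Xx else 0%R.

Lemma config_to_point x : points X x -> config (to_point x) = x.
Proof. by rewrite /to_point; case: pselect. Qed.

Lemma configK : cancel (@config _ _ _ X) to_point.
Proof.
by move=> x; apply: config_inj; rewrite config_to_point //; exact: configP.
Qed.

Definition recode_config (x : full_shift G A) := recode (to_point x).

Lemma recode_configE x : recode_config (config x) = recode x.
Proof. by rewrite /recode_config configK. Qed.

Lemma recode_config_image : recode_config @` points X = range recode.
Proof.
rewrite eqEsubset; split=> _ [x Xx <-]; first by exists (to_point x).
by exists (config x); [exact: configP|exact: recode_configE].
Qed.

Lemma recode_continuous : {within points X, continuous recode_config}.
Proof.
apply/within_continuous_full_shiftP => p g Xp.
exists (translates [:: g] N) => x Xx px; apply/cellP; apply: openI.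
apply: (@agree_translates _ _ [:: g]); last exact: mem_head.
by rewrite !config_to_point.
Qed.

(** The image is closed as a continuous image of a compact set in a Hausdorff space. *)
Lemma recode_subshift : subshift (range recode).
Proof.
split; last first.
  by move=> g y [x _ xy]; exists (pshift g x); rewrite // -recode_shift xy.
apply: compact_closed; first exact: full_shift_hausdorff.
rewrite -recode_config_image; apply: continuous_compact recode_continuous _.
exact: closed_compact_full_shift (points_subshift X).1.
Qed.

Lemma recode_zero_block_code :
  block_code setT (range recode) (nullary_map (fun=> cell 0%R)).
Proof.
by apply: (@cellwise_block_code _ _ _ _ _ _ (fun=> cell 0%R)) => // x _;
  exists 0%R; rewrite ?recode0.
Qed.

Lemma recode_scale_block_code a :
  block_code (range recode) (range recode) (unary_map (cell_scale a)).
Proof.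
apply: (@cellwise_block_code _ _ _ _ _ _ (fun b => cell (a *: lift b)%R)) => //.
by move=> y [x _ xy]; exists (a *: x)%R; rewrite // recodeZ xy.
Qed.

Lemma recode_add_block_code :
  block_code (square (range recode)) (range recode) (binary_map cell_add).
Proof.
apply: (@cellwise_block_code _ _ _ _ _ _
  (fun b => cell (lift b.1 + lift b.2)%R)) => //.
move=> z [[x _ xz] [y _ yz]]; exists (x + y)%R => //.
by rewrite recodeD xz yz.
Qed.

Lemma recode_bracket_block_code :
  block_code (square (range recode)) (range recode) (binary_map cell_bracket).
Proof.
apply: (@cellwise_block_code _ _ _ _ _ _
  (fun b => cell (pbracket (lift b.1) (lift b.2)))) => //.
move=> z [[x _ xz] [y _ yz]]; exists (pbracket x y) => //.
by rewrite recode_bracket xz yz.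
Qed.

(** Every point of the image is some [recode x], so each axiom is transported from [lie_point]. *)
Lemma recode_lie_algebra :
  lie_algebra_on (range recode)
    (fun=> cell 0%R) cell_scale cell_add cell_bracket.
Proof.
have [brl brr] := (@pbracket_linearl _ _ _ X, @pbracket_linearr _ _ _ X).
split.
- split=> [|a _ [x _ <-]|_ _ [x _ <-] [y _ <-]|_ _ [x _ <-] [y _ <-]].
  + by exists 0%R; rewrite ?recode0.
  + by exists (a *: x)%R; rewrite ?recodeZ.
  + by exists (x + y)%R; rewrite ?recodeD.
  + by exists (pbracket x y); rewrite ?recode_bracket.
- split=> [_ _ _ [x _ <-] [y _ <-] [z _ <-]|_ _ [x _ <-] [y _ <-]|_ [x _ <-]|
    _ [x _ <-]].
  + by rewrite -!recodeD addrA.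
  + by rewrite -!recodeD addrC.
  + by rewrite -recode0 -recodeD add0r.
  + exists (recode (- x)%R); first by exists (- x)%R.
    by rewrite -recodeD addNr recode0.
- split=> [a b _ [x _ <-]|_ [x _ <-]|a _ _ [x _ <-] [y _ <-]|a b _ [x _ <-]].
  + by rewrite -!recodeZ scalerA.
  + by rewrite -!recodeZ scale1r.
  + by rewrite -!(recodeZ, recodeD) scalerDr.
  + by rewrite -!(recodeZ, recodeD) scalerDl.
- split=> [_ _ _ [x _ <-] [y _ <-] [z _ <-]|_ _ _ [x _ <-] [y _ <-] [z _ <-]|
    a _ _ [x _ <-] [y _ <-]|a _ _ [x _ <-] [y _ <-]].
  + by rewrite -!(recode_bracket, recodeD) (brDl brl).
  + by rewrite -!(recode_bracket, recodeD) (brDr brr).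
  + rewrite -!(recode_bracket, recodeZ); congr recode.
    by rewrite -[(a *: x)%R]addr0 brl (br0l brl) addr0.
  + rewrite -!(recode_bracket, recodeZ); congr recode.
    by rewrite -[(a *: y)%R]addr0 brr (br0r brr) addr0.
- split=> [_ [x _ <-]|_ _ _ [x _ <-] [y _ <-] [z _ <-]].
  + by rewrite -recode_bracket pbracketxx recode0.
  + by rewrite -!(recode_bracket, recodeD) pbracket_jacobi recode0.
Qed.

Definition recoding : lie_subshift K G B :=
  LieSubshift recode_subshift recode_zero_block_code recode_scale_block_code
    recode_add_block_code recode_bracket_block_code recode_lie_algebra.

Lemma recoding_cellwise : cellwise recoding.
Proof.
split=> [|a||].
- exact: (@cellwise_neighborhood _ _ _ _ _ (fun=> cell 0%R)).
- exact: (@cellwise_neighborhood _ _ _ _ _ (fun b => cell (a *: lift b)%R)).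
- exact: (@cellwise_neighborhood _ _ _ _ _
    (fun b => cell (lift b.1 + lift b.2)%R)).
- exact: (@cellwise_neighborhood _ _ _ _ _
    (fun b => cell (pbracket (lift b.1) (lift b.2)))).
Qed.

Lemma recode_conjugacy : topological_conjugacy X recoding recode_config.
Proof.
split; split.
- by move=> x _; exists (to_point x).
- exact: recode_continuous.
- move=> g x Xx; rewrite recode_shift -recode_configE; congr recode_config.
  by rewrite /config/= -[in LHS](config_to_point Xx).
- by move=> x _; exists (to_point x).
- move=> x y /set_mem Xx /set_mem Xy /recode_inj xy.
  by rewrite -(config_to_point Xx) xy config_to_point.
- move=> _ [x _ <-].
  by exists (config x); [exact: configP|exact: recode_configE].
Qed.

Lemma recode_morphism : lie_morphism X recoding recode_config.
Proof.
split=> [|a x Xx|x y Xx Xy|x y Xx Xy].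
- exact: etrans (recode_configE 0%R) recode0.
- rewrite -{1}(config_to_point Xx).
  exact: etrans (recode_configE (a *: to_point x)%R) (recodeZ _ _).
- rewrite -{1}(config_to_point Xx) -{1}(config_to_point Xy).
  exact: etrans (recode_configE (to_point x + to_point y)%R) (recodeD _ _).
- rewrite -{1}(config_to_point Xx) -{1}(config_to_point Xy).
  exact: etrans (recode_configE (pbracket _ _)) (recode_bracket _ _).
Qed.

Lemma recoding_cellwiseable : cellwiseable X.
Proof.
exists B, recoding, recode_config; split.
- exact: recoding_cellwise.
- exact: recode_conjugacy.
- exact: recode_morphism.
Qed.
End Recoding.

Theorem theorem9 (G : groupType) (K : finFieldType) (A : finType)
    (X : lie_subshift K G A) :
  virtually_polycyclic G ->
  X `<=` closure (homoclinic X) ->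
  cellwiseable X.
Proof.
move=> _ dense; have [I [idealI oI subI]] := inert_ideal dense.
have [N NI] := nbhs0_sub oI.
exact: (recoding_cellwiseable idealI subI NI).
Qed.
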